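(* Suppose $M/N$ is a weakly irreducible, symmetric, strongly separable extension (with bimodule projection $E:M\to N$) such that $E$ has dual bases lying in the centralizer $U=C_M(N)$. Suppose moreover that the center of $U$ coincides with the center of $N$. Then $M/N$ has depth $2$.
   Context: $k$ is a field and algebras are unital associative $k$-algebras; $C_X(Y)$ is the centralizer of $Y$ in $X$; summation over repeated indices is understood. An algebra extension $M/N$ is Frobenius if there are an $N$-$N$-bimodule map $E:M\to N$ (Frobenius homomorphism) and finite families $\{x_i\},\{y_i\}$ in $M$ (dual bases for $E$) with $E(mx_i)y_i=m=x_iE(y_im)$ for all $m\in M$. It is strongly separable of index $\lambda^{-1}$ if moreover $E(1)=1$ and $x_iy_i=\lambda^{-1}1$ with $0\ne\lambda\in k$. It is symmetric if $E(ux)=E(xu)$ for all $x\in M$, $u\in U=C_M(N)$. A Markov trace is a trace $T:N\to k$ with $T(1)=1$ such that $T_0=T\circ E$ is a trace on $M$. $M/N$ is weakly irreducible if $U$ is a Kanzaki separable $k$-algebra (i.e. has a separability element invariant under the flip) and $T_0|_U$ is a non-degenerate trace, where $T$ is the given Markov trace. Basic construction: $M_1=M\otimes_NM$, $e_1=1\otimes1$, $me_1m'=m\otimes m'$, product $(me_1m')(ne_1n')=mE(m'n)e_1n'$, unit $x_ie_1y_i$, $M\subset M_1$ via $m\mapsto mx_ie_1y_i$, $E_M:M_1\to M$, $E_M(me_1m')=\lambda mm'$; this is again strongly separable of index $\lambda^{-1}$ over $M$. Iterating for $M_1/M$ gives $M_2=M_1e_2M_1$ with $E_{M_1}:M_2\to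 M_1$, $E_{M_1}(xe_2y)=\lambda xy$. $M/N$ has depth $2$ if $E_M$ has dual bases lying in $A=C_{M_1}(N)$ and $E_{M_1}$ has dual bases lying in $B=C_{M_2}(M)$. *)

(* Defs.v *)
From HB Require Import structures.
From mathcomp Require Import all_boot all_algebra.
From mathcomp Require Import boolp classical_sets.

Set Implicit Arguments.
Unset Strict Implicit.
Unset Printing Implicit Defensive.

Import GRing.Theory.
Local Open Scope ring_scope.
Local Open Scope classical_set_scope.
Local Open Scope quotient_scope.

(* M (x)_N M for rings N, M and a map i : N -> M: formal sums of pairs modulo
   the usual relations. Only the underlying function of i matters here; it is
   a ring morphism in all uses. *)
Section TensorSquare.
Variables (N M : nzRingType) (i : N -> M).

Inductive tens_rel : seq (M * M) -> seq (M * M) -> Prop :=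
| TensRefl s : tens_rel s s
| TensSym s t : tens_rel s t -> tens_rel t s
| TensTrans s t u : tens_rel s t -> tens_rel t u -> tens_rel s u
| TensCat s s' t t' :
    tens_rel s s' -> tens_rel t t' -> tens_rel (s ++ t) (s' ++ t')
| TensComm s t : tens_rel (s ++ t) (t ++ s)
| TensZero y : tens_rel [:: (0, y)] [::]
| TensAddl x x' y : tens_rel [:: (x + x', y)] [:: (x, y); (x', y)]
| TensAddr x y y' : tens_rel [:: (x, y + y')] [:: (x, y); (x, y')]
| TensBal x n y : tens_rel [:: (x * i n, y)] [:: (x, i n * y)].

Definition tens_relb (s t : seq (M * M)) : bool := `[< tens_rel s t >].

Lemma tens_relb_refl : reflexive tens_relb.
Proof. by move=> s; apply/asboolP; exact: TensRefl. Qed.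

Lemma tens_relb_sym : symmetric tens_relb.
Proof. by move=> s t; apply: asbool_equiv_eq; split; exact: TensSym. Qed.

Lemma tens_relb_trans : transitive tens_relb.
Proof.
by move=> t s u /asboolP st /asboolP tu; apply/asboolP; exact: TensTrans tu.
Qed.

Canonical tens_equiv :=
  EquivRel tens_relb tens_relb_refl tens_relb_sym tens_relb_trans.

Definition tensor := {eq_quot tens_equiv}.
HB.instance Definition _ := Choice.on tensor.
HB.instance Definition _ := EqQuotient.on tensor.

Lemma tens_piP (s t : seq (M * M)) : (\pi_tensor s = \pi_tensor t) <-> tens_rel s t.
Proof.
split=> [/eqmodP /asboolP //|st].
by apply/eqmodP; apply/asboolP.
Qed.

Lemma tens_reprP (s : seq (M * M)) : tens_rel (repr (\pi_tensor s)) s.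
Proof. by apply/tens_piP; rewrite reprK. Qed.

Definition tens (x y : M) : tensor := \pi_tensor [:: (x, y)].

Definition tens_zero : tensor := \pi_tensor [::].
Definition tens_add (s t : tensor) : tensor := \pi_tensor (repr s ++ repr t).
Definition tens_opp (s : tensor) : tensor :=
  \pi_tensor [seq (- p.1, p.2) | p <- repr s].

Lemma tens_addE s t :
  tens_add (\pi_tensor s) (\pi_tensor t) = \pi_tensor (s ++ t).
Proof. by apply/tens_piP; apply: TensCat; apply: tens_reprP. Qed.

Lemma tens_addA : associative tens_add.
Proof.
elim/quotW=> s; elim/quotW=> t; elim/quotW=> u.
by rewrite (tens_addE t u) (tens_addE s t) (tens_addE s) (tens_addE _ u) catA.
Qed.

Lemma tens_addC : commutative tens_add.
Proof.
elim/quotW=> s; elim/quotW=> t; rewrite (tens_addE s t) (tens_addE t s).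
by apply/tens_piP; apply: TensComm.
Qed.

Lemma tens_add0 : left_id tens_zero tens_add.
Proof. by elim/quotW=> s; rewrite tens_addE. Qed.

Lemma tens_rel_opp s : tens_rel ([seq (- p.1, p.2) | p <- s] ++ s) [::].
Proof.
elim: s => [|[x y] s IHs]; first exact: TensRefl.
set s' := [seq _ | p <- s] in IHs *.
have e1 : tens_rel ((- x, y) :: s' ++ (x, y) :: s)
    ([:: (- x, y)] ++ ((s' ++ s) ++ [:: (x, y)])).
  rewrite -catA; apply: (@TensCat [:: _] [:: _] (s' ++ _)); first exact: TensRefl.
  by apply: TensCat; [exact: TensRefl | exact: (TensComm [:: (x, y)] s)].
have e2 : tens_rel ([:: (- x, y)] ++ ((s' ++ s) ++ [:: (x, y)]))
    [:: (- x, y); (x, y)].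
  apply: (@TensCat [:: _] [:: _] _ [:: _]); first exact: TensRefl.
  by apply: (@TensCat _ [::] _ [:: _]) => //; exact: TensRefl.
apply: TensTrans e1 _; apply: TensTrans e2 _; apply: TensTrans (TensZero y).
by rewrite -[X in tens_rel _ [:: (X, y)]](addNr x); apply: TensSym (TensAddl _ _ _).
Qed.

Lemma tens_addN : left_inverse tens_zero tens_opp tens_add.
Proof.
move=> s; rewrite -[in X in tens_add _ X](reprK s) tens_addE.
by apply/tens_piP; exact: tens_rel_opp.
Qed.

HB.instance Definition _ :=
  GRing.isZmodule.Build tensor tens_addA tens_addC tens_add0 tens_addN.

Lemma tens_piD s t : \pi_tensor (s ++ t) = \pi_tensor s + \pi_tensor t.
Proof. by rewrite -tens_addE. Qed.

Lemma tensDl x x' y : tens (x + x') y = tens x y + tens x' y.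
Proof. by rewrite -tens_piD; apply/tens_piP; exact: TensAddl. Qed.

Lemma tensDr x y y' : tens x (y + y') = tens x y + tens x y'.
Proof. by rewrite -tens_piD; apply/tens_piP; exact: TensAddr. Qed.

Lemma tens_bal x n y : tens (x * i n) y = tens x (i n * y).
Proof. by apply/tens_piP; exact: TensBal. Qed.

Lemma tens_suml I (r : seq I) (F : I -> M) y :
  tens (\sum_(j <- r) F j) y = \sum_(j <- r) tens (F j) y.
Proof.
elim/big_ind2: _ => // [|_ s x t <- <-]; last exact: tensDl.
by apply: (@addrI _ (tens 0 y)); rewrite -tensDl !addr0.
Qed.

Lemma tens_sumr I (r : seq I) (F : I -> M) x :
  tens x (\sum_(j <- r) F j) = \sum_(j <- r) tens x (F j).
Proof.
elim/big_ind2: _ => // [|_ s y t <- <-]; last exact: tensDr.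
by apply: (@addrI _ (tens x 0)); rewrite -tensDr !addr0.
Qed.

Lemma tens_ind (P : tensor -> Prop) :
  P 0 -> (forall x y, P (tens x y)) -> (forall s t, P s -> P t -> P (s + t)) ->
  forall t, P t.
Proof.
move=> P0 P1 PD t; rewrite -[t]reprK; elim: (repr t) => // [[x y] s IHs].
by rewrite -cat1s tens_piD; apply: PD IHs; apply: P1.
Qed.

Section Lift.
Variable G : zmodType.

Definition balanced (f : M -> M -> G) : Prop :=
  [/\ forall x x' y, f (x + x') y = f x y + f x' y,
      forall x y y', f x (y + y') = f x y + f x y'
    & forall x n y, f (x * i n) y = f x (i n * y)].

Definition tens_lift (f : M -> M -> G) (hf : balanced f) (t : tensor) : G :=
  \sum_(p <- repr t) f p.1 p.2.

Variables (f : M -> M -> G) (hf : balanced f).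

Lemma tens_lift_rel s t : tens_rel s t ->
  \sum_(p <- s) f p.1 p.2 = \sum_(p <- t) f p.1 p.2.
Proof.
case: hf => fDl fDr fb.
elim=> {s t} // [s t u _ -> _ -> //|s s' t t' _ e _ e'|s t|y|x x' y|x y y'|x n y].
- by rewrite !big_cat /= e e'.
- by rewrite !big_cat /= addrC.
- rewrite big_seq1 big_nil /=.
  by apply: (@addrI _ (f 0 y)); rewrite -fDl !addr0.
- by rewrite !big_cons !big_nil /= !addr0 fDl.
- by rewrite !big_cons !big_nil /= !addr0 fDr.
- by rewrite !big_seq1 fb.
Qed.

Lemma tens_liftE x y : tens_lift hf (tens x y) = f x y.
Proof. by rewrite /tens_lift (tens_lift_rel (tens_reprP _)) big_seq1. Qed.

Lemma tens_lift_additive : zmod_morphism (tens_lift hf).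
Proof.
have D s t : tens_lift hf (s + t) = tens_lift hf s + tens_lift hf t.
  by rewrite /tens_lift (tens_lift_rel (tens_reprP _)) big_cat.
move=> s t; apply: (@addIr _ (tens_lift hf t)).
by rewrite -D !subrK.
Qed.

HB.instance Definition _ :=
  GRing.isZmodMorphism.Build tensor G (tens_lift hf) tens_lift_additive.
End Lift.
End TensorSquare.

Section TensorLmodule.
Variables (k : fieldType) (N : nzRingType) (M : algType k) (i : N -> M).
Implicit Types (c : k) (t : tensor i).

Lemma tens_scale_balanced c : balanced i (fun x y => tens i (c *: x) y).
Proof.
split=> [x x' y|x y y'|x n y]; first by rewrite scalerDr tensDl.
  exact: tensDr.
by rewrite scalerAl tens_bal.
Qed.

Definition tens_scale c : tensor i -> tensor i :=
  tens_lift (tens_scale_balanced c).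

Lemma tens_scaleE c x y : tens_scale c (tens i x y) = tens i (c *: x) y.
Proof. exact: tens_liftE. Qed.

Lemma tens_scaleDr : right_distributive tens_scale +%R.
Proof. by move=> c s t; rewrite /tens_scale raddfD. Qed.

Lemma tens_scaleA c d t : tens_scale c (tens_scale d t) = tens_scale (c * d) t.
Proof.
elim/tens_ind: t => [|x y|s t es et].
- by rewrite /tens_scale !raddf0.
- by rewrite !tens_scaleE scalerA.
- by rewrite !tens_scaleDr es et.
Qed.

Lemma tens_scale1 : left_id 1 tens_scale.
Proof.
elim/tens_ind=> [|x y|s t es et].
- by rewrite /tens_scale !raddf0.
- by rewrite !tens_scaleE scale1r.
- by rewrite !tens_scaleDr es et.
Qed.

Lemma tens_scaleDl t : {morph tens_scale^~ t : c d / c + d}.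
Proof.
move=> c d; elim/tens_ind: t => [|x y|s t es et].
- by rewrite /tens_scale !raddf0 addr0.
- by rewrite !tens_scaleE scalerDl tensDl.
- by rewrite !tens_scaleDr es et addrACA.
Qed.

HB.instance Definition _ := GRing.Zmodule_isLmodule.Build k (tensor i)
  tens_scaleA tens_scale1 tens_scaleDr tens_scaleDl.

Lemma tensZl c x y : tens i (c *: x) y = c *: tens i x y.
Proof. by rewrite -tens_scaleE. Qed.
End TensorLmodule.

Definition centralizer (X : nzRingType) (Y : set X) : set X :=
  [set x | forall y, Y y -> x * y = y * x].

(* The center of a subalgebra S of X, as a subset of X. *)
Definition center_of (X : nzRingType) (S : set X) : set X :=
  S `&` centralizer S.

(* C_X(Y) as an algebra in its own right. *)
Section CentralizerAlgebra.
Variables (k : fieldType) (X : algType k) (Y : set X).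

Definition in_centralizer : {pred X} := fun x => `[< centralizer Y x >].

Lemma in_centralizerP x : reflect (centralizer Y x) (x \in in_centralizer).
Proof. exact: asboolP. Qed.

Lemma centralizer_subalg_closed : GRing.subsemialg_closed in_centralizer.
Proof.
split.
- by apply/in_centralizerP => y _; rewrite mul1r mulr1.
- split; first by apply/in_centralizerP => y _; rewrite mul0r mulr0.
  move=> u v /in_centralizerP hu /in_centralizerP hv.
  by apply/in_centralizerP => y hy; rewrite mulrDl mulrDr hu // hv.
- move=> c u /in_centralizerP hu; apply/in_centralizerP => y hy.
  by rewrite -scalerAl -scalerAr hu.
- move=> u v /in_centralizerP hu /in_centralizerP hv.
  by apply/in_centralizerP => y hy; rewrite -mulrA hv // mulrA hu // mulrA.
Qed.

HB.instance Definition _ :=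
  GRing.isSubalgClosed.Build k X in_centralizer centralizer_subalg_closed.

Record centralizer_alg := CentralizerAlg {
  centralizer_val :> X;
  centralizer_valP : centralizer_val \in in_centralizer
}.

HB.instance Definition _ := [isSub for centralizer_val].
HB.instance Definition _ := [Choice of centralizer_alg by <:].
HB.instance Definition _ := [SubChoice_isSubAlgebra of centralizer_alg by <:].
End CentralizerAlgebra.

(* The tensors are taken in U (x)_k U; the last clause is invariance under the
   flip. *)
Definition kanzaki_separable (k : fieldType) (U : algType k) : Prop :=
  exists (n : nat) (a b : 'I_n -> U),
    let ten := tens (fun c : k => c%:A : U) in
    [/\ \sum_j a j * b j = 1,
        forall u, \sum_j ten (u * a j) (b j) = \sum_j ten (a j) (b j * u)
      & \sum_j ten (a j) (b j) = \sum_j ten (b j) (a j)].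

(* An algebra extension M/N is given by its structure morphism i : N -> M.
   For a strongly separable extension i is automatically injective, since
   E (i a) = a. *)
Section Extension.
Variables (k : fieldType) (N M : algType k) (i : {lrmorphism N -> M}).

Definition bimodule_map (E : M -> N) : Prop :=
  forall a m b, E (i a * m * i b) = a * E m * b.

Definition dual_bases (E : M -> N) n (x y : 'I_n -> M) : Prop :=
  forall m, \sum_j i (E (m * x j)) * y j = m /\
            \sum_j x j * i (E (y j * m)) = m.

Definition has_dual_bases_in (E : M -> N) (S : set M) : Prop :=
  exists (n : nat) (x y : 'I_n -> M),
    [/\ dual_bases E x y, forall j, S (x j) & forall j, S (y j)].

(* The dual bases are data, but neither the algebra [basic_construction] below
   nor any later notion depends on their choice. Linearity over k of E follows
   from [bimodule_map] and additivity. *)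
Record strongly_separable := StronglySeparable {
  ss_E : {linear M -> N};
  ss_lambda : k;
  ss_size : nat;
  ss_x : 'I_ss_size -> M;
  ss_y : 'I_ss_size -> M;
  ss_bimodule : bimodule_map ss_E;
  ss_dual : dual_bases ss_E ss_x ss_y;
  ss_E1 : ss_E 1 = 1;
  ss_lambda_neq0 : ss_lambda != 0;
  ss_indexP : \sum_j ss_x j * ss_y j = ss_lambda^-1 *: 1
}.
End Extension.

Arguments ss_x {k N M i} s j : rename.
Arguments ss_y {k N M i} s j : rename.

Section BasicConstruction.
Variables (k : fieldType) (N M : algType k) (i : {lrmorphism N -> M}).

(* S is a phantom argument on the carrier: it determines the multiplication. *)
Definition basic_construction (S : strongly_separable i) : Type := tensor i.

Variable S : strongly_separable i.
Local Notation E := (ss_E S).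
Local Notation lam := (ss_lambda S).
Local Notation x := (ss_x S).
Local Notation y := (ss_y S).

Local Notation M1 := (basic_construction S).
HB.instance Definition _ := GRing.Lmodule.on M1.

(* m e_1 m' *)
Definition bc_tens (m m' : M) : M1 := tens i m m'.
Local Notation "m ** m'" := (bc_tens m m') (at level 40).

Lemma bc_ind (P : M1 -> Prop) :
  P 0 -> (forall m m', P (m ** m')) -> (forall s t, P s -> P t -> P (s + t)) ->
  forall t, P t.
Proof. exact: tens_ind. Qed.

Lemma ss_El a m : E (i a * m) = a * E m.
Proof. by have := ss_bimodule S a m 1; rewrite rmorph1 !mulr1. Qed.

Lemma ss_Er m b : E (m * i b) = E m * b.
Proof. by have := ss_bimodule S 1 m b; rewrite rmorph1 !mul1r. Qed.

Lemma bc_mulr_balanced (m m' : M) :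
  balanced i (fun n n' => m * i (E (m' * n)) ** n').
Proof.
split=> [n n1 n'|n n' n1|n a n'].
- by rewrite mulrDr !raddfD /= mulrDr; exact: tensDl.
- exact: tensDr.
- by rewrite mulrA ss_Er rmorphM mulrA; exact: tens_bal.
Qed.

Lemma bc_mul_balanced (t : M1) :
  balanced i (fun m m' => tens_lift (bc_mulr_balanced m m') t).
Proof.
have ext G (f g : {additive M1 -> G}) : (forall n n', f (n ** n') = g (n ** n')) ->
    forall t, f t = g t.
  move=> fg; elim/bc_ind=> [|n n'|u v eu ev]; rewrite ?raddf0 ?raddfD //.
  by rewrite eu ev.
split=> [m m1 m'|m m' m1|m a m'].
- elim/bc_ind: t => [|n n'|u v eu ev]; rewrite ?raddf0 ?addr0 ?raddfD //=.
    by rewrite !tens_liftE mulrDl; exact: tensDl.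
  by rewrite eu ev addrACA.
- elim/bc_ind: t => [|n n'|u v eu ev]; rewrite ?raddf0 ?addr0 ?raddfD //=.
    by rewrite !tens_liftE mulrDl !raddfD /= mulrDr; exact: tensDl.
  by rewrite eu ev addrACA.
- apply: ext => n n'; rewrite /= !tens_liftE -mulrA -rmorphM.
  by rewrite -mulrA ss_El.
Qed.

Definition bc_mul (s t : M1) : M1 := tens_lift (bc_mul_balanced t) s.

Lemma bc_mulE m m' n n' :
  bc_mul (m ** m') (n ** n') = (m * i (E (m' * n))) ** n'.
Proof. by rewrite /bc_mul !tens_liftE. Qed.

Lemma bc_mulDl : left_distributive bc_mul +%R.
Proof. by move=> s t u; rewrite /bc_mul raddfD. Qed.

Lemma bc_mulDr : right_distributive bc_mul +%R.
Proof.
move=> s t u; elim/bc_ind: s => [|m m'|s s' es es'].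
- by rewrite /bc_mul !raddf0 addr0.
- by rewrite /bc_mul !tens_liftE raddfD.
- by rewrite !bc_mulDl es es' addrACA.
Qed.

Lemma bc_mul0 : left_zero 0 bc_mul.
Proof. by move=> s; rewrite /bc_mul raddf0. Qed.

Lemma bc_mulr0 : right_zero 0 bc_mul.
Proof. by move=> s; apply: (@addrI _ (bc_mul s 0)); rewrite -bc_mulDr !addr0. Qed.

Lemma bc_mulA : associative bc_mul.
Proof.
elim/bc_ind=> [|a a'|s s' es es'] t u.
- by rewrite !bc_mul0.
- elim/bc_ind: t => [|b b'|t t' et et'].
  + by rewrite bc_mul0 !bc_mulr0 bc_mul0.
  + elim/bc_ind: u => [|c c'|u u' eu eu']; first by rewrite !bc_mulr0.
      by rewrite !bc_mulE mulrA ss_Er rmorphM mulrA.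
    by rewrite !bc_mulDr eu eu'.
  + by rewrite bc_mulDr !bc_mulDl -et -et' bc_mulDr.
- by rewrite !bc_mulDl es es'.
Qed.

(* m x_i e_1 y_i *)
Definition bc_incl (m : M) : M1 := \sum_j (m * x j) ** (y j).

Definition bc_one : M1 := \sum_j (x j) ** (y j).

Lemma bc_mul_suml I (r : seq I) (F : I -> M1) t :
  bc_mul (\sum_(j <- r) F j) t = \sum_(j <- r) bc_mul (F j) t.
Proof. by rewrite /bc_mul raddf_sum. Qed.

Lemma bc_mul_sumr I (r : seq I) (F : I -> M1) t :
  bc_mul t (\sum_(j <- r) F j) = \sum_(j <- r) bc_mul t (F j).
Proof.
by elim/big_ind2: _ => // [|_ u z v <- <-]; rewrite ?bc_mulr0 ?bc_mulDr.
Qed.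

Lemma bc_inclMl m n n' : bc_mul (bc_incl m) (n ** n') = (m * n) ** n'.
Proof.
rewrite /bc_incl bc_mul_suml; under eq_bigr do rewrite bc_mulE -mulrA.
rewrite -[LHS](tens_suml i) -mulr_sumr.
by have [_ ->] := ss_dual S n.
Qed.

Lemma bc_inclMr m n n' : bc_mul (n ** n') (bc_incl m) = n ** (n' * m).
Proof.
rewrite /bc_incl bc_mul_sumr.
have e j : bc_mul (n ** n') ((m * x j) ** y j) = n ** (i (E (n' * m * x j)) * y j).
  by rewrite bc_mulE mulrA; exact: tens_bal.
rewrite (eq_bigr _ (fun j _ => e j)).
rewrite -[LHS](tens_sumr i).
by have [-> _] := ss_dual S (n' * m).
Qed.

Lemma bc_oneE : bc_one = bc_incl 1.
Proof. by apply: eq_bigr => j _; rewrite mul1r. Qed.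

Lemma bc_mul1r : left_id bc_one bc_mul.
Proof.
rewrite bc_oneE; elim/bc_ind=> [|m m'|s t es et]; first by rewrite bc_mulr0.
  by rewrite bc_inclMl mul1r.
by rewrite bc_mulDr es et.
Qed.

Lemma bc_mulr1 : right_id bc_one bc_mul.
Proof.
rewrite bc_oneE; elim/bc_ind=> [|m m'|s t es et]; first by rewrite bc_mul0.
  by rewrite bc_inclMr mulr1.
by rewrite bc_mulDl es et.
Qed.

Lemma bc_E_balanced : balanced i (fun m m' : M => lam *: (m * m')).
Proof.
split=> [m n m'|m m' n'|m a m']; first by rewrite mulrDl scalerDr.
  by rewrite mulrDr scalerDr.
by rewrite mulrA.
Qed.

Definition bc_E : M1 -> M := tens_lift bc_E_balanced.

Lemma bc_EE m m' : bc_E (m ** m') = lam *: (m * m').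
Proof. exact: tens_liftE. Qed.

Lemma bc_scaleE c m m' : c *: (m ** m') = (c *: m) ** m'.
Proof. exact: esym (tensZl i c m m'). Qed.

Lemma bc_E_linear : linear bc_E.
Proof.
move=> c s t; rewrite /bc_E raddfD /= -/bc_E; congr (_ + _).
elim/bc_ind: s => [|m m'|u v eu ev].
- by rewrite scaler0 /bc_E !raddf0.
- by rewrite bc_scaleE -!/bc_E !bc_EE -scalerAl !scalerA mulrC.
- by rewrite scalerDr /bc_E !raddfD /= -/bc_E eu ev.
Qed.

HB.instance Definition _ := GRing.isLinear.Build k M1 M *:%R bc_E bc_E_linear.

Lemma bc_E_one : bc_E bc_one = 1.
Proof.
rewrite /bc_one linear_sum /=; under eq_bigr do rewrite bc_EE.
by rewrite -scaler_sumr ss_indexP scalerA divff ?ss_lambda_neq0 // scale1r.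
Qed.

Lemma bc_one_neq0 : bc_one != 0.
Proof.
apply/eqP => e; have := bc_E_one; rewrite e linear0 => /esym/eqP.
by rewrite oner_eq0.
Qed.

HB.instance Definition _ := GRing.Zmodule_isNzRing.Build M1
  bc_mulA bc_mul1r bc_mulr1 bc_mulDl bc_mulDr bc_one_neq0.

Lemma bc_scaleAl (c : k) (s t : M1) : c *: (s * t) = (c *: s) * t.
Proof.
elim/bc_ind: s => [|m m'|u v eu ev]; first by rewrite mul0r !scaler0 mul0r.
- elim/bc_ind: t => [|n n'|u v eu ev]; first by rewrite !mulr0 scaler0.
    by rewrite bc_scaleE -[_ * _]/(bc_mul _ _) [X in _ = X]bc_mulE bc_mulE bc_scaleE scalerAl.
  by rewrite !mulrDr scalerDr eu ev.
- by rewrite mulrDl !scalerDr mulrDl eu ev.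
Qed.

HB.instance Definition _ := GRing.Lmodule_isLalgebra.Build k M1 bc_scaleAl.

Lemma bc_scaleAr (c : k) (s t : M1) : c *: (s * t) = s * (c *: t).
Proof.
elim/bc_ind: s => [|m m'|u v eu ev]; first by rewrite !mul0r scaler0.
- elim/bc_ind: t => [|n n'|u v eu ev]; first by rewrite !mulr0 scaler0 mulr0.
    rewrite bc_scaleE -![_ * _]/(bc_mul _ _) [X in _ = X]bc_mulE bc_mulE bc_scaleE.
    by rewrite -[in RHS]scalerAr !linearZ /= scalerAr.
  by rewrite mulrDr !scalerDr mulrDr eu ev.
- by rewrite !mulrDl scalerDr eu ev.
Qed.

HB.instance Definition _ := GRing.Lalgebra_isAlgebra.Build k M1 bc_scaleAr.

Lemma bc_incl_linear : linear bc_incl.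
Proof.
move=> c m n; rewrite /bc_incl scaler_sumr -big_split; apply: eq_bigr => j _ /=.
by rewrite mulrDl [LHS](tensDl i) bc_scaleE scalerAl.
Qed.

Lemma bc_incl_monoid : monoid_morphism bc_incl.
Proof.
split; first by rewrite -bc_oneE.
move=> m n; rewrite {2 3}/bc_incl -[RHS]/(bc_mul _ _) bc_mul_sumr.
by apply: eq_bigr => j _; rewrite bc_inclMl mulrA.
Qed.

HB.instance Definition _ :=
  GRing.isLinear.Build k M M1 *:%R bc_incl bc_incl_linear.
HB.instance Definition _ :=
  GRing.isMonoidMorphism.Build M M1 bc_incl bc_incl_monoid.

Lemma bc_bimodule : bimodule_map bc_incl bc_E.
Proof.
move=> a t b; elim/bc_ind: t => [|m m'|s t es et].
- by rewrite !(mulr0, mul0r, linear0).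
- rewrite -[bc_incl a * _]/(bc_mul _ _) bc_inclMl.
  rewrite -[_ * bc_incl b]/(bc_mul _ _) bc_inclMr !bc_EE.
  by rewrite -scalerAr -scalerAl !mulrA.
- by rewrite mulrDr mulrDl !linearD /= es et mulrDr mulrDl.
Qed.

Lemma bc_dual : dual_bases bc_incl bc_E
  (fun j => lam^-1 *: (x j ** 1)) (fun j => 1 ** y j).
Proof.
have lam0 := ss_lambda_neq0 S.
move=> t; split.
- elim/bc_ind: t => [|m m'|s t es et].
  + by rewrite big1 // => j _; rewrite mul0r !linear0 mul0r.
  + rewrite -[RHS](bc_mulr1 (m ** m')) /bc_one bc_mul_sumr; apply: eq_bigr => j _.
    rewrite -scalerAr -[(m ** m') * _]/(bc_mul _ _) bc_mulE linearZ /= bc_EE.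
    rewrite scalerA mulVf // scale1r mulr1.
    by rewrite -[LHS]/(bc_mul _ _) bc_inclMl mulr1 bc_mulE.
  + rewrite -{2}es -{2}et -big_split; apply: eq_bigr => j _ /=.
    by rewrite mulrDl !raddfD /= mulrDl.
- elim/bc_ind: t => [|m m'|s t es et].
  + by rewrite big1 // => j _; rewrite mulr0 !linear0 mulr0.
  + rewrite -[RHS](bc_mul1r (m ** m')) /bc_one bc_mul_suml; apply: eq_bigr => j _.
    rewrite -[(1 ** y j) * _]/(bc_mul _ _) bc_mulE mul1r bc_EE.
    rewrite !linearZ /= -scalerAl -scalerAr scalerA mulVf // scale1r.
    rewrite -[LHS]/(bc_mul _ _) bc_inclMr mul1r bc_mulE.
    exact: esym (tens_bal i _ _ _).
  + rewrite -{2}es -{2}et -big_split; apply: eq_bigr => j _ /=.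
    by rewrite mulrDr !raddfD /= mulrDr.
Qed.

Lemma bc_indexP :
  \sum_j (lam^-1 *: (x j ** 1)) * (1 ** y j) = lam^-1 *: 1 :> M1.
Proof.
rewrite -[1 in RHS]/bc_one /bc_one scaler_sumr; apply: eq_bigr => j _.
rewrite -scalerAl -[(x j ** 1) * _]/(bc_mul _ _) bc_mulE mulr1.
by rewrite ss_E1 rmorph1 mulr1.
Qed.

Definition bc_strongly_separable : strongly_separable bc_incl :=
  @StronglySeparable k M M1 bc_incl bc_E lam _ _ _
    bc_bimodule bc_dual bc_E_one (ss_lambda_neq0 S) bc_indexP.
End BasicConstruction.

Section Notions.
Variables (k : fieldType) (N M : algType k) (i : {lrmorphism N -> M}).
Variable S : strongly_separable i.

Definition symmetric_ext : Prop :=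
  forall m u, centralizer (range i) u -> ss_E S (u * m) = ss_E S (m * u).

Definition markov_trace (T : {scalar N}) : Prop :=
  [/\ forall a b, T (a * b) = T (b * a),
      T 1 = 1
    & forall m m', T (ss_E S (m * m')) = T (ss_E S (m' * m))].

(* For u, v in U, (u, v) |-> T (E (u * v)) is the bilinear form of T_0|_U. *)
Definition weakly_irreducible (T : {scalar N}) : Prop :=
  kanzaki_separable (centralizer_alg (range i)) /\
  (forall u : M, centralizer (range i) u ->
     (forall v : M, centralizer (range i) v -> T (ss_E S (u * v)) = 0) -> u = 0).

(* A = C_{M_1}(N) and B = C_{M_2}(M), where M_1 = basic_construction S and
   M_2 = basic_construction S1. *)
Definition depth2 : Prop :=
  let S1 := bc_strongly_separable S in
  let S2 := bc_strongly_separable S1 in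
  has_dual_bases_in (bc_incl S) (ss_E S1)
    (centralizer (range (bc_incl S \o i))) /\
  has_dual_bases_in (bc_incl S1) (ss_E S2)
    (centralizer (range (bc_incl S1 \o bc_incl S))).
End Notions.

(* Main.v *)
Require Import Defs.
From mathcomp Require Import all_boot all_algebra.
From mathcomp Require Import boolp classical_sets.

(** Neither half of depth two needs a dual basis to be found from scratch: if
    [(u_j), (v_j)] are dual bases for [E] in [C_M(N)], then
    [(lambda^-1 u_j e_1), (e_1 v_j)] are dual bases for [E_M] in [C_{M_1}(N)]
    ([has_dual_bases_bc]). Applied to [M/N] this is the first half. Applied to
    [M_1/M] it reduces the second half to finding dual bases for [E_M] in
    [C_{M_1}(M)] ([has_dual_bases_relative_commutant]).

    View [M_1] as acting on [M], with [M] acting by left multiplications and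
    [e_1] by [E]. Right multiplication [rho(w)] by an element [w] of the
    centralizer [U] belongs to [M_1], being [sum_l u_l w e_1 v_l], and commutes
    with [M]. The candidates are [rho(u_j)] and [rho(v_j)]. That they are dual
    bases for [E_M] comes down to the identity
    [lambda * sum_j u_j w v_j = E(w)] for [w] in [U] ([casimir_average]), which
    says that [e_1] is itself the combination [lambda * sum_j u_j rho(v_j)] of
    left and right multiplications, so that [M_1] is generated by [M] and the
    [rho(w)].

    The identity is where the hypotheses on the centre and on symmetry enter.
    Put [z = lambda * sum_j u_j w v_j]. This is [E_M(rho(w))], and [E_M] maps
    the centralizer of [M] into the centre of [M]; so [z] is central in [U], hence
    lies in [N], and [E(z) = z]. Symmetry of [E] makes [(v_j), (u_j)] dual bases
    as well, and [rho(w)] does not depend on the dual bases used to write it;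
    so [z = lambda * sum_j v_j w u_j], and rotating under [E] gives
    [E(z) = lambda * E(w sum_j u_j v_j) = E(w)], since
    [sum_j u_j v_j = lambda^-1]. *)

Set Implicit Arguments.
Unset Strict Implicit.
Unset Printing Implicit Defensive.

Import GRing.Theory.
Local Open Scope ring_scope.
Local Open Scope classical_set_scope.

(** * Dual bases and the basic construction *)

Section BasicConstructionDualBases.
Variables (k : fieldType) (N M : algType k) (i : {lrmorphism N -> M}).
Variable S : strongly_separable i.
Local Notation E := (ss_E S).
Local Notation E_M := (ss_E (bc_strongly_separable S)).
Local Notation lam := (ss_lambda S).
Local Notation "m ** m'" := (bc_tens S m m') (at level 40).

Lemma bc_tens_mulE m m' n n' :
  (m ** m') * (n ** n') = (m * i (E (m' * n))) ** n'.
Proof. exact: bc_mulE. Qed.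

Lemma bc_incl_mull m n n' : bc_incl S m * (n ** n') = (m * n) ** n'.
Proof. exact: bc_inclMl. Qed.

Lemma bc_incl_mulr m n n' : (n ** n') * bc_incl S m = n ** (n' * m).
Proof. exact: bc_inclMr. Qed.

Lemma bc_expectE m m' : E_M (m ** m') = lam *: (m * m').
Proof. exact: bc_EE. Qed.

Lemma bc_tens_bal m a m' : (m * i a) ** m' = m ** (i a * m').
Proof. exact: tens_bal. Qed.

Lemma bc_tens_suml I (r : seq I) (F : I -> M) m' :
  (\sum_(j <- r) F j) ** m' = \sum_(j <- r) F j ** m'.
Proof. exact: tens_suml. Qed.

Lemma bc_tens_sumr I (r : seq I) (F : I -> M) m :
  m ** (\sum_(j <- r) F j) = \sum_(j <- r) m ** F j.
Proof. exact: tens_sumr. Qed.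

Variables (n : nat) (u v : 'I_n -> M).
Hypothesis uv_dual : dual_bases i E u v.

Lemma dual_basisl m : \sum_j i (E (m * u j)) * v j = m.
Proof. by have [] := uv_dual m. Qed.

Lemma dual_basisr m : \sum_j u j * i (E (v j * m)) = m.
Proof. by have [] := uv_dual m. Qed.

(** The unit is defined through the chosen dual bases; multiplying it by
    [sum_j u_j e_1 v_j] expands each [x_l] along [(u_j), (v_j)]. *)
Lemma sum_dual_tens : \sum_j u j ** v j = 1.
Proof.
rewrite -[LHS]mulr1 -[1 in LHS]/(bc_one S) -[RHS]/(bc_one S) /bc_one.
rewrite mulr_sumr; apply: eq_bigr => l _.
rewrite mulr_suml; under eq_bigr do rewrite bc_tens_mulE.
by rewrite -bc_tens_suml dual_basisr.
Qed.

Lemma sum_dual_mul : \sum_j u j * v j = lam^-1 *: 1.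
Proof.
have /(congr1 (fun m => lam^-1 *: m)) := ss_E1 (bc_strongly_separable S).
rewrite -sum_dual_tens (linear_sum E_M); under eq_bigr do rewrite bc_expectE.
by rewrite -scaler_sumr scalerA mulVf ?ss_lambda_neq0 // scale1r.
Qed.

(** Since [E_M(t u_j e_1) e_1 = lambda t u_j e_1] for all [t], both expansions
    reduce to multiplication by [sum_j u_j e_1 v_j = 1]. *)
Lemma bc_dual_bases :
  dual_bases (bc_incl S) E_M
    (fun j => lam^-1 *: (u j ** 1)) (fun j => 1 ** v j).
Proof.
have lam0 := ss_lambda_neq0 S.
move=> t; split.
- rewrite -[RHS]mulr1 -sum_dual_tens mulr_sumr; apply: eq_bigr => j _.
  elim/bc_ind: t => [|m m'|s t es et].
  + by rewrite !mul0r !linear0 mul0r.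
  + rewrite -scalerAr bc_tens_mulE (linearZ_LR E_M) bc_expectE scalerA mulVf //.
    by rewrite scale1r mulr1 bc_incl_mull mulr1 bc_tens_mulE.
  + by rewrite !mulrDl !linearD /= mulrDl es et.
- rewrite -[RHS]mul1r -sum_dual_tens mulr_suml; apply: eq_bigr => j _.
  elim/bc_ind: t => [|m m'|s t es et].
  + by rewrite !mulr0 !linear0 mulr0.
  + rewrite bc_tens_mulE mul1r bc_expectE linearZ /= -scalerAl -scalerAr scalerA.
    rewrite mulVf // scale1r.
    by rewrite bc_incl_mulr mul1r bc_tens_mulE bc_tens_bal.
  + by rewrite !mulrDr !linearD /= mulrDr es et.
Qed.

End BasicConstructionDualBases.

(** If [u] centralizes [N] then so do [u e_1] and [e_1 u], because [e_1] does:
    it is balanced over [N]. *)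
Lemma has_dual_bases_bc (k : fieldType) (N M : algType k)
    (i : {lrmorphism N -> M}) (S : strongly_separable i) :
  has_dual_bases_in i (ss_E S) (centralizer (range i)) ->
  has_dual_bases_in (bc_incl S) (ss_E (bc_strongly_separable S))
    (centralizer (range (bc_incl S \o i))).
Proof.
move=> [n [u [v [uv_dual uU vU]]]].
exists n, (fun j => (ss_lambda S)^-1 *: bc_tens S (u j) 1),
  (fun j => bc_tens S 1 (v j)).
split=> [|j _ [a _ <-]|j _ [a _ <-]] /=; first exact: bc_dual_bases.
- have ua : u j * i a = i a * u j by apply: uU; exists a.
  rewrite -scalerAl -scalerAr bc_incl_mull bc_incl_mulr -ua mul1r.
  by rewrite bc_tens_bal mulr1.
- have va : v j * i a = i a * v j by apply: vU; exists a.
  by rewrite bc_incl_mull bc_incl_mulr va mulr1 -bc_tens_bal mul1r.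
Qed.

(** * Right multiplications in the basic construction *)

Section CentralizerDualBases.
Variables (k : fieldType) (N M : algType k) (i : {lrmorphism N -> M}).
Variable S : strongly_separable i.
Local Notation E := (ss_E S).
Local Notation E_M := (ss_E (bc_strongly_separable S)).
Local Notation lam := (ss_lambda S).
Local Notation U := (centralizer (range i)).
Local Notation "m ** m'" := (bc_tens S m m') (at level 40).

Lemma centralizer_range_comm w a : U w -> w * i a = i a * w.
Proof. by apply; exists a. Qed.

Lemma ss_E_range a : E (i a) = a.
Proof. by rewrite -[i a]mulr1 ss_El ss_E1 mulr1. Qed.

(** The operator of right multiplication by [w], in the action of [M_1] on [M]
    described above; it is meant for [w] centralizing [N]. *)
Definition right_mul (w : M) : basic_construction S :=
  \sum_j (ss_x S j * w) ** ss_y S j.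

Lemma right_mul_tens w m m' : U w -> right_mul w * (m ** m') = (m * w) ** m'.
Proof.
move=> wU.
rewrite mulr_suml -{2}(dual_basisr (ss_dual S) m) mulr_suml bc_tens_suml.
apply: eq_bigr => j _.
by rewrite bc_tens_mulE -!mulrA centralizer_range_comm.
Qed.

Lemma right_mul_incl n (u v : 'I_n -> M) w m : dual_bases i E u v -> U w ->
  right_mul w * bc_incl S m = \sum_j (m * u j * w) ** v j.
Proof.
move=> uv_dual wU; rewrite -[X in _ * X]mulr1 -(sum_dual_tens uv_dual).
rewrite (mulr_sumr _ _ _ (bc_incl S m)) mulr_sumr.
by apply: eq_bigr => j _; rewrite bc_incl_mull right_mul_tens.
Qed.

Lemma right_mulE n (u v : 'I_n -> M) w : dual_bases i E u v -> U w ->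
  right_mul w = \sum_j (u j * w) ** v j.
Proof.
move=> uv_dual wU; rewrite -[LHS]mulr1 -(rmorph1 (bc_incl S)).
by rewrite (right_mul_incl 1 uv_dual wU); under eq_bigr do rewrite mul1r.
Qed.

Lemma right_mul_comm w m : U w ->
  right_mul w * bc_incl S m = bc_incl S m * right_mul w.
Proof.
move=> wU; rewrite (right_mul_incl m (ss_dual S) wU) /right_mul mulr_sumr.
by apply: eq_bigr => j _; rewrite bc_incl_mull mulrA.
Qed.

Lemma expect_right_mulE n (u v : 'I_n -> M) w : dual_bases i E u v -> U w ->
  E_M (right_mul w) = lam *: \sum_j u j * w * v j.
Proof.
move=> uv_dual wU; rewrite (right_mulE uv_dual wU) (linear_sum E_M) scaler_sumr.
by apply: eq_bigr => j _; exact: bc_expectE.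
Qed.

(** As [E_M] is a bimodule map, it sends the centralizer of [M] into the centre
    of [M]. *)
Lemma expect_right_mul_central w m : U w ->
  m * E_M (right_mul w) = E_M (right_mul w) * m.
Proof. by move=> wU; rewrite -ss_El -ss_Er right_mul_comm. Qed.

Hypothesis E_sym : symmetric_ext S.

(** The coefficients lie in [N], so they commute with bases taken in [U], and
    symmetry turns one expansion into the other. *)
Lemma dual_bases_sym n (u v : 'I_n -> M) :
  (forall j, U (u j)) -> (forall j, U (v j)) ->
  dual_bases i E u v -> dual_bases i E v u.
Proof.
move=> uU vU uv_dual m; split.
- rewrite -[RHS](dual_basisr uv_dual); apply: eq_bigr => j _.
  by rewrite centralizer_range_comm // (E_sym _ (vU j)).
- rewrite -[RHS](dual_basisl uv_dual); apply: eq_bigr => j _.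
  by rewrite centralizer_range_comm // (E_sym _ (uU j)).
Qed.

(** As operators on [M] both sides send [x] to [m E(m' x w) = m E(w m' x)], by
    symmetry of [E]. *)
Lemma tens_right_mul w m m' : U w -> (m ** m') * right_mul w = m ** (w * m').
Proof.
move=> wU.
rewrite mulr_sumr -[w * m'](dual_basisl (ss_dual S)) bc_tens_sumr.
apply: eq_bigr => j _.
by rewrite bc_tens_mulE bc_tens_bal -(mulrA w) (E_sym _ wU) mulrA.
Qed.

Hypothesis center_sub : center_of U `<=` range i.

Variables (n : nat) (u v : 'I_n -> M).
Hypothesis uv_dual : dual_bases i E u v.
Hypotheses (uU : forall j, U (u j)) (vU : forall j, U (v j)).

(** The value is computed by evaluating [E] on it, which is legitimate since
    [center_sub] puts it in [N], where [E] is the identity. *)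
Lemma casimir_average w : U w -> lam *: (\sum_j u j * w * v j) = i (E w).
Proof.
move=> wU; rewrite -(expect_right_mulE uv_dual wU).
have [a _ za] : range i (E_M (right_mul w)).
  by apply: center_sub; split=> y _; rewrite expect_right_mul_central.
rewrite -za -[a]ss_E_range za; congr (i _).
rewrite (expect_right_mulE (dual_bases_sym uU vU uv_dual) wU) linearZ linear_sum.
under eq_bigr do rewrite -mulrA (E_sym _ (vU _)) -mulrA.
rewrite -linear_sum -mulr_sumr (sum_dual_mul uv_dual) -scalerAr mulr1 linearZ /=.
by rewrite scalerA divff ?ss_lambda_neq0 // scale1r.
Qed.

(** This is the identity [e_1 = lambda * sum_j u_j rho(v_j)], multiplied by
    [m] on the left and by [m'] on the right. *)
Lemma right_mul_gen m m' :
  \sum_j bc_incl S (lam *: (m * u j * m')) * right_mul (v j) = m ** m'.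
Proof.
transitivity (\sum_j \sum_l (lam *: (m * (u j * u l * v j))) ** (v l * m')).
  apply: eq_bigr => j _.
  have e : right_mul (v j) * bc_incl S m' = \sum_l (u l * v j) ** (v l * m').
    rewrite (right_mulE uv_dual (vU j)) [LHS]mulr_suml.
    by apply: eq_bigr => l _; rewrite bc_incl_mulr.
  rewrite linearZ rmorphM -scalerAl -mulrA -right_mul_comm // e.
  rewrite (mulr_sumr _ _ _ (bc_incl S _)) scaler_sumr.
  by apply: eq_bigr => l _; rewrite bc_incl_mull bc_scaleE !mulrA.
rewrite exchange_big /=.
transitivity (\sum_l m ** (i (E (1 * u l)) * v l * m')).
  apply: eq_bigr => l _; rewrite -bc_tens_suml -scaler_sumr -mulr_sumr.
  by rewrite scalerAr casimir_average // bc_tens_bal mul1r mulrA.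
by rewrite -bc_tens_sumr -mulr_suml (dual_basisl uv_dual) mul1r.
Qed.

End CentralizerDualBases.

(** * Dual bases in the relative commutant, and depth two *)

(** On [t = m e_1 m'], [E_M(t rho(u_j))] and [E_M(rho(v_j) t)] are
    [lambda m u_j m'] and [lambda m v_j m'], so the two expansions are
    [right_mul_gen] for [(u_j), (v_j)] and for [(v_j), (u_j)]. *)
Lemma has_dual_bases_relative_commutant (k : fieldType) (N M : algType k)
    (i : {lrmorphism N -> M}) (S : strongly_separable i) :
  symmetric_ext S -> center_of (centralizer (range i)) `<=` range i ->
  has_dual_bases_in i (ss_E S) (centralizer (range i)) ->
  has_dual_bases_in (bc_incl S) (ss_E (bc_strongly_separable S))
    (centralizer (range (bc_incl S))).
Proof.
move=> E_sym center_sub [n [u [v [uv_dual uU vU]]]].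
exists n, (fun j => right_mul S (u j)), (fun j => right_mul S (v j)).
split=> [t|j _ [m _ <-]|j _ [m _ <-]]; last 2 first.
- exact: right_mul_comm.
- exact: right_mul_comm.
split; elim/bc_ind: t => [|m m'|s t es et].
- by rewrite big1 // => j _; rewrite mul0r !linear0 mul0r.
- rewrite -[RHS](right_mul_gen E_sym center_sub uv_dual uU vU).
  apply: eq_bigr => j _.
  by rewrite tens_right_mul // bc_expectE mulrA.
- rewrite -{2}es -{2}et -big_split; apply: eq_bigr => j _ /=.
  by rewrite mulrDl !linearD mulrDl.
- by rewrite big1 // => j _; rewrite mulr0 !linear0 mulr0.
- have vu_dual := dual_bases_sym E_sym uU vU uv_dual.
  rewrite -[RHS](right_mul_gen E_sym center_sub vu_dual vU uU).
  apply: eq_bigr => j _.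
  by rewrite right_mul_comm // right_mul_tens // bc_expectE.
- rewrite -{2}es -{2}et -big_split; apply: eq_bigr => j _ /=.
  by rewrite mulrDr !linearD mulrDr.
Qed.

Theorem proposition5p3 (k : fieldType) (N M : algType k)
    (i : {lrmorphism N -> M}) (S : strongly_separable i) (T : {scalar N})
    (hT : markov_trace S T) (hirr : weakly_irreducible S T)
    (hsym : symmetric_ext S)
    (hdual : has_dual_bases_in i (ss_E S) (centralizer (range i)))
    (hcenter : center_of (centralizer (range i)) = center_of (range i)) :
  depth2 S.
Proof.
have center_sub : center_of (centralizer (range i)) `<=` range i.
  by rewrite hcenter => z [].
split; apply: has_dual_bases_bc => //.
exact: has_dual_bases_relative_commutant.
Qed.
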